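(* Let $Q(\underline{x}) = x_1^2 + x_2^2 - 2x_3^2$ and $F=\{\underline{x}\in\mathbb{Z}^3 : x_2>x_1>0,\ x_3>0\}$. Then: (1) The three matrices $$N_1=\begin{bmatrix}0&1&0\\-3&0&4\\-2&0&3\end{bmatrix},\quad N_2=\begin{bmatrix}0&1&0\\3&0&4\\2&0&3\end{bmatrix},\quad N_3=\begin{bmatrix}1&0&0\\0&3&4\\0&2&3\end{bmatrix}$$ together with the base triple $(1,7,5)^T$ form a matrix generating system for the primitive solutions of $Q(\underline x)=0$ in $F$. (2) Under the conjugacy map $\pi(x,y)=\frac{y-x}{x+1}$, the 1-dimensional dynamical system corresponding to this generating system is the map on $(0,\sqrt2)$ (defined off finitely many points) $$T_3(t)=\begin{cases}\frac{t}{1-t}& t\in\left(0,\frac{\sqrt2}{1+\sqrt2}\right),\\ \frac{2-2t}{t}& t\in\left(\frac{\sqrt2}{1+\sqrt2},1\right),\\ \frac{2t-2}{2-t}& t\in(1,\sqrt2).\end{cases}$$ (3) The measure $d\mu=\frac1t\,dt$ on $(0,\sqrt2)$ is $\sigma$-finite, $T_3$-invariant, ergodic and conservative.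
   Context: A solution $(a,b,c)^T\in\mathbb{Z}^3$ of $Q=0$ is primitive if $a,b,c$ have no common divisor greater than $1$. Matrix generating system: matrices $N_1,\dots,N_k$ and a finite set of base triples form a matrix generating system for the primitive solutions in $F$ if the vectors $N_{a_1}N_{a_2}\cdots N_{a_n}\underline{b}$ ($n\ge 0$, $a_j\in\{1,\dots,k\}$, $\underline b$ a base triple) are exactly the primitive solutions of $Q=0$ in $F$, and every primitive solution in $F$ has exactly one representation of this form (unique $n$, $a_1,\dots,a_n$ and $\underline b$). Corresponding 1-dimensional system: let $\mathcal{E}=\{(x,y)\in\mathbb{R}^2: Q(x,y,1)=0\}$ and let $FA\subset\mathcal{E}$ be the arc of points $(x,y)$ with $y>x>0$. A matrix $A$ preserving $Q$ acts on points $(x,y)$ of $\mathcal{E}$ by $\widehat{A}(x,y)=(v_1/v_3,v_2/v_3)$ where $(v_1,v_2,v_3)^T=A(x,y,1)^T$. Put $\mathcal{D}_i=FA\cap\widehat{N_i}(FA)$; these sets are pairwise disjoint and cover $FA$ up to finitely many points. The system is the map $\widehat{T}$ on $FA$ (defined off finitely many points) given by $\widehat T=\widehat{N_i^{-1}}$ on $\mathcal{D}_i$. That $T_3$ is this system under the conjugacy map $\pi$ means that $\pi: FA\to(0,\sqrt2)$ is a homeomorphism and $T_3=\pi\circ\widehat T\circ\pi^{-1}$ off finitely many points. A measure $\mu$ is $T$-invariant if $\mu(T^{-1}A)=\mu(A)$ for all Borel $A$; ergodic if $T^{-1}A=A$ implies $\mu(A)=0$ or $\mu(A^c)=0$; conservative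 if there is no set $W$ of positive measure with $W,T^{-1}W,T^{-2}W,\dots$ pairwise disjoint. Statements about $T$ are understood off the Lebesgue-null set of points where some iterate is undefined. *)

(* Defs.v *)
From HB Require Import structures.
From mathcomp Require Import all_boot all_order all_algebra.
From mathcomp Require Import all_classical all_reals all_analysis.
From mathcomp Require Import measurable_realfun.
Set Implicit Arguments.
Unset Strict Implicit.
Unset Printing Implicit Defensive.
Import Order.TTheory GRing.Theory Num.Theory.
Import numFieldNormedType.Exports.
Local Open Scope classical_set_scope.
Local Open Scope ring_scope.

Definition vec3 {S : Type} (a b c : S) : 'cV[S]_3 :=
  \col_(i < 3) nth c [:: a; b] i.

Definition mat3 {S : Type} (r0 r1 r2 : 'cV[S]_3) : 'M[S]_3 :=
  \matrix_(i < 3, j < 3) nth r2 [:: r0; r1] i j 0.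

Definition Q {S : comPzRingType} (x : 'cV[S]_3) : S :=
  x 0 0 ^+ 2 + x 1 0 ^+ 2 - 2%:R * x 2 0 ^+ 2.

Definition primitive (x : 'cV[int]_3) : Prop :=
  forall d : int, (forall i, (d %| x i 0%R)%Z) -> d <= 1.

Definition F : set 'cV[int]_3 :=
  [set x | [/\ 0 < x 0 0, x 0 0 < x 1 0 & 0 < x 2 0]].

Definition primitive_solutions (G : set 'cV[int]_3) : set 'cV[int]_3 :=
  [set x | [/\ Q x = 0, primitive x & G x]].

(* The pair p consists of the word a_1 ... a_n and the base triple. *)
Definition generated k (N : 'I_k -> 'M[int]_3)
    (p : seq 'I_k * 'cV[int]_3) : 'cV[int]_3 :=
  (\prod_(a <- p.1) N a) *m p.2.

Definition matrix_generating_system k (N : 'I_k -> 'M[int]_3)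
    (base : seq 'cV[int]_3) (G : set 'cV[int]_3) : Prop :=
  generated N @` [set p | p.2 \in base] = primitive_solutions G /\
  forall x, primitive_solutions G x ->
    exists! p, p.2 \in base /\ generated N p = x.

Definition N1 : 'M[int]_3 :=
  mat3 (vec3 0 1 0) (vec3 (- 3) 0 4) (vec3 (- 2) 0 3).
Definition N2 : 'M[int]_3 :=
  mat3 (vec3 0 1 0) (vec3 3 0 4) (vec3 2 0 3).
Definition N3 : 'M[int]_3 :=
  mat3 (vec3 1 0 0) (vec3 0 3 4) (vec3 0 2 3).
Definition N (i : 'I_3) : 'M[int]_3 := nth N3 [:: N1; N2] i.

Section OneDimensionalSystem.
Context {R : realType}.

Definition arcE : set (R * R) := [set p | Q (vec3 p.1 p.2 1) = 0].
Definition FA : set (R * R) := arcE `&` [set p | 0 < p.1 < p.2].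

Definition hat (A : 'M[R]_3) (p : R * R) : R * R :=
  let v := A *m vec3 p.1 p.2 1 in (v 0 0 / v 2 0, v 1 0 / v 2 0).

Variables (k : nat) (M : 'I_k -> 'M[int]_3).

Definition realmx (A : 'M[int]_3) : 'M[R]_3 := map_mx intr A.

Definition arcD (i : 'I_k) : set (R * R) := FA `&` hat (realmx (M i)) @` FA.

Definition hatT_dom : set (R * R) := \bigcup_i arcD i.

(* Only meaningful on hatT_dom, and when the sets arcD i are disjoint. *)
Definition hatT (p : R * R) : R * R :=
  if [pick i | `[< arcD i p >]] is Some i
  then hat (invmx (realmx (M i))) p else p.

Definition system_well_defined : Prop :=
  [/\ forall i x, Q (realmx (M i) *m x) = Q x,
      trivIset setT arcD &
      finite_set (FA `\` hatT_dom)].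

(* T, with domain of definition D, is a map on B given off finitely many
   points. *)
Definition is_system_under (pi : R * R -> R) (B D : set R) (T : R -> R) :=
  [/\ system_well_defined, D `<=` B, finite_set (B `\` D) &
  exists g : R -> R * R,
    [/\ set_bij FA B pi, {homo g : t / B t >-> FA t},
        (forall t, B t -> pi (g t) = t),
        {within FA, continuous pi} & {within B, continuous g}] /\
    exists S : set R, finite_set S /\
      forall t, B t -> ~ S t ->
        [/\ D t, hatT_dom (g t) & T t = pi (hatT (g t))]].

Definition conj_map (p : R * R) : R := (p.2 - p.1) / (p.1 + 1).

Definition sqrt2 : R := Num.sqrt 2.

Definition T3_dom : set R :=
  `]0, sqrt2 / (1 + sqrt2)[ `|` `]sqrt2 / (1 + sqrt2), 1[ `|` `]1, sqrt2[.

Definition T3 (t : R) : R :=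
  if t < sqrt2 / (1 + sqrt2) then t / (1 - t)
  else if t < 1 then (2 - 2 * t) / t
  else (2 * t - 2) / (2 - t).

End OneDimensionalSystem.

(* The points all of whose iterates under f, a map defined on D, exist. *)
Definition all_iterates_defined (U : Type) (D : set U) (f : U -> U) : set U :=
  [set t | forall n, D (iter n f t)].

(* Here f acts on the set X, and the measure considered is mu on X. *)
Section Dynamics.
Context d (U : measurableType d) (R : realType).
Variables (mu : {measure set U -> \bar R}) (X : set U) (f : U -> U).

Definition invariant_measure : Prop :=
  measurable_fun X f /\
  forall A, measurable A -> A `<=` X -> mu (X `&` f @^-1` A) = mu A.

Definition ergodic_measure : Prop :=
  forall A, measurable A -> A `<=` X -> X `&` f @^-1` A = A ->
    mu A = 0%E \/ mu (X `\` A) = 0%E.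

Definition conservative_measure : Prop :=
  ~ exists W, [/\ measurable W, W `<=` X, (0 < mu W)%E &
      trivIset setT (fun n => X `&` iter n f @^-1` W)].

End Dynamics.

(* The measure dt/t on ]0, sqrt 2[, as a measure on the Borel sets of R. *)
Section InvMeasure.
Context {R : realType}.
Local Open Scope ereal_scope.

Definition mu_inv (A : set (measurableTypeR R)) : \bar R :=
  \int[@lebesgue_measure R]_(t in A `&` `]0%R, sqrt2[) (t^-1)%:E.

Let mu_inv0 : mu_inv set0 = 0.
Proof. by rewrite /mu_inv set0I integral_set0. Qed.

Let mu_inv_ge0 A : 0 <= mu_inv A.
Proof.
apply: integral_ge0 => t [_] /=; rewrite in_itv/= => /andP[t0 _].
by rewrite lee_fin invr_ge0 ltW.
Qed.

Let measurable_inv_itv :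
  measurable_fun (`]0%R, sqrt2[ : set (measurableTypeR R)) (fun t : R => (t^-1)%:E).
Proof.
apply/measurable_EFinP; apply: open_continuous_measurable_fun => //.
move=> t; rewrite inE/= in_itv/= => /andP[t0 _].
by apply: inv_continuous; rewrite gt_eqF.
Qed.

Let mu_inv_sigma_additive : semi_sigma_additive mu_inv.
Proof.
move=> /= G mG tG mUG; apply: cvg_toP.
  by apply: is_cvg_ereal_nneg_natsum_cond => n _ _; exact: mu_inv_ge0.
rewrite /mu_inv setI_bigcupl ge0_integral_bigcup//=.
- by move=> n; exact: measurableI.
- apply: measurable_funS measurable_inv_itv => //.
  by apply: bigcup_sub => n _; exact: subIsetr.
- move=> t [n _ [_]] /=; rewrite in_itv/= => /andP[t0 _].
  by rewrite lee_fin invr_ge0 ltW.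
- exact: trivIset_setIr.
Qed.

HB.instance Definition _ := isMeasure.Build _ _ _ mu_inv
  mu_inv0 mu_inv_ge0 mu_inv_sigma_additive.

End InvMeasure.

(* Main.v *)
(* Writing b' = 3b - 4c and c' = 3c - 2b, each N_i^-1 sends a triple (a, b, c) to a signed
   arrangement of a, b', c', and exactly one choice stays in F unless b' = a, which only happens at
   (1, 7, 5); the third coordinate decreases, which gives the unique factorization.

   The slope parametrization t |-> arc_of t inverts conj_map and carries N_1, N_2, N_3 to the inverse
   branches y/(y+1), 2/(y+2), (2y+2)/(y+2) of T3. The dt/t-lengths of the three preimages of ]a, b]
   add up to ln b - ln a, whence invariance.

   Every orbit enters ]cut, sqrt 2[, a set of finite measure, infinitely often; a wandering set W
   would satisfy sum_n mu (W /\ T^-n E) <= mu E for such a set E, so it is null by Borel-Cantelli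
   (Maharam's recurrence theorem).

   A composition of inverse branches is (ay+b)/(cy+d) with a, b, c, d >= 0, and c <= d as soon as its
   innermost factor is not the parabolic branch, so that its distortion on ]0, sqrt 2[ is bounded
   uniformly. An invariant set A of positive measure thus fills a definite proportion of arbitrarily
   small neighbourhoods of every point, and Lebesgue's density theorem makes it conull. *)
Require Import Defs.
From mathcomp Require Import all_boot all_order all_algebra.
From mathcomp Require Import all_classical all_reals all_analysis.
From mathcomp Require Import measurable_realfun.
From mathcomp Require Import ring lra zify.
Import Order.TTheory GRing.Theory Num.Theory.
Import numFieldNormedType.Exports.
Local Open Scope classical_set_scope.
Local Open Scope ring_scope.

(** * Primitive solutions *)

Lemma vec3_eta (S : Type) (x : 'cV[S]_3) : x = vec3 (x 0 0) (x 1 0) (x 2 0).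
Proof.
apply/matrixP => i j; rewrite mxE ord1.
by case: i => [[|[|[|//]]] i] /=; congr (x _ _); exact/val_inj.
Qed.

Lemma vec3E (S : Type) (a b c : S) :
  (vec3 a b c 0 0 = a) * (vec3 a b c 1 0 = b) * (vec3 a b c 2 0 = c).
Proof. by rewrite !mxE. Qed.

Lemma ord3_cases (i : 'I_3) : [\/ i = 0, i = 1 | i = 2].
Proof.
by case: i => [[|[|[|//]]] i]; [apply: Or31|apply: Or32|apply: Or33]; exact/val_inj.
Qed.

(** Over an arbitrary commutative ring, so that one computation serves integer triples and real
    points alike. *)
Lemma N_mul (S : comPzRingType) (i : 'I_3) (a b c : S) :
  map_mx intr (N i) *m vec3 a b c =
  nth (vec3 a (3 * b + 4 * c) (2 * b + 3 * c))
    [:: vec3 b (4 * c - 3 * a) (3 * c - 2 * a);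
        vec3 b (3 * a + 4 * c) (2 * a + 3 * c)] i.
Proof.
apply/matrixP => k j; rewrite ord1 {j}.
have [-> | -> | ->] := ord3_cases i; have [-> | -> | ->] := ord3_cases k;
  rewrite !mxE !big_ord_recr big_ord0 /= !mxE /=; ring.
Qed.

Lemma N_mulZ (i : 'I_3) (a b c : int) :
  N i *m vec3 a b c =
  nth (vec3 a (3 * b + 4 * c) (2 * b + 3 * c))
    [:: vec3 b (4 * c - 3 * a) (3 * c - 2 * a);
        vec3 b (3 * a + 4 * c) (2 * a + 3 * c)] i.
Proof.
rewrite -N_mul; congr (_ *m _); apply/matrixP => k j.
by rewrite !mxE intz.
Qed.

Lemma Q_vec3 (S : comPzRingType) (a b c : S) :
  Q (vec3 a b c) = a ^+ 2 + b ^+ 2 - 2 * c ^+ 2.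
Proof. by rewrite /Q !vec3E. Qed.

Lemma N_Q (S : comPzRingType) (i : 'I_3) (x : 'cV[S]_3) :
  Q (map_mx intr (N i) *m x) = Q x.
Proof.
rewrite (vec3_eta _ x) N_mul.
by have [-> | -> | ->] := ord3_cases i; rewrite /= !Q_vec3; ring.
Qed.

Lemma primitive_vec3 (a b c : int) : primitive (vec3 a b c) <->
  forall d : int, (d %| a)%Z -> (d %| b)%Z -> (d %| c)%Z -> d <= 1.
Proof.
split=> p d.
  move=> da db dc; apply: p => i.
  by have [-> | -> | ->] := ord3_cases i; rewrite vec3E.
by move=> dv; apply: p; [have := dv 0|have := dv 1|have := dv 2]; rewrite vec3E.
Qed.

(** The [N i] are unimodular: the entries of [x] and of [N i *m x] are integer combinations of each
    other, hence have the same common divisors. *)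
Lemma primitive_N (i : 'I_3) (x : 'cV[int]_3) :
  primitive (N i *m x) <-> primitive x.
Proof.
rewrite (vec3_eta _ x) N_mulZ; move: (x 0 0) (x 1 0) (x 2 0) => a b c {x}.
have D (d m n k l : int) : (d %| m)%Z -> (d %| n)%Z -> (d %| k * m + l * n)%Z.
  by move=> dm dn; rewrite rpredD ?dvdz_mull.
have [-> | -> | ->] := ord3_cases i; rewrite /= !primitive_vec3;
  split=> p d d1 d2 d3; apply: p => //.
- by rewrite (_ : _ - _ = 4 * c + (-3) * a); [exact: D|ring].
- by rewrite (_ : _ - _ = 3 * c + (-2) * a); [exact: D|ring].
- by rewrite (_ : a = 4 * (3 * c - 2 * a) + (-3) * (4 * c - 3 * a)); [exact: D|ring].
- by rewrite (_ : c = 3 * (3 * c - 2 * a) + (-2) * (4 * c - 3 * a)); [exact: D|ring].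
- exact: D.
- exact: D.
- by rewrite (_ : a = 3 * (3 * a + 4 * c) + (-4) * (2 * a + 3 * c)); [exact: D|ring].
- by rewrite (_ : c = 3 * (2 * a + 3 * c) + (-2) * (3 * a + 4 * c)); [exact: D|ring].
- exact: D.
- exact: D.
- by rewrite (_ : b = 3 * (3 * b + 4 * c) + (-4) * (2 * b + 3 * c)); [exact: D|ring].
- by rewrite (_ : c = 3 * (2 * b + 3 * c) + (-2) * (3 * b + 4 * c)); [exact: D|ring].
Qed.

Lemma F_vec3 (a b c : int) : F (vec3 a b c) <-> [/\ 0 < a, a < b & 0 < c].
Proof. by rewrite /F/= !vec3E. Qed.

(** The delicate case is [N1], which needs [b < 4c - 3a]; on the cone,
    [(4c)^2 - (3a + b)^2 = (b - a)(7b + a)]. *)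
Lemma N_F (i : 'I_3) (x : 'cV[int]_3) : Q x = 0 -> F x -> F (N i *m x).
Proof.
rewrite (vec3_eta _ x) N_mulZ; move: (x 0 0) (x 1 0) (x 2 0) => a b c {x}.
rewrite Q_vec3 F_vec3 => q [a0 ab c0].
have [-> | -> | ->] := ord3_cases i; rewrite /= F_vec3; split=> //; nia.
Qed.

Lemma primitive_solutions_N (i : 'I_3) (x : 'cV[int]_3) :
  primitive_solutions F x -> primitive_solutions F (N i *m x).
Proof.
move=> [q p f]; split; [|exact/primitive_N|exact: N_F].
rewrite -[RHS]q -[RHS](N_Q _ i); congr (Q (_ *m _)).
by apply/matrixP => k j; rewrite mxE intz.
Qed.

(** On the image of [(a, b, c)] the form [3 x_2 - 4 x_3] takes the value [-a], [a], [b] for [N1],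
    [N2], [N3], while the first coordinate is [b], [b], [a]. So the form is negative, between 0 and
    the first coordinate, or above it, which identifies the matrix. *)
Lemma N_F_inj (i j : 'I_3) (x y : 'cV[int]_3) :
  F x -> F y -> N i *m x = N j *m y -> i = j /\ x = y.
Proof.
rewrite (vec3_eta _ x) (vec3_eta _ y) !N_mulZ.
move: (x 0 0) (x 1 0) (x 2 0) (y 0 0) (y 1 0) (y 2 0) => {x y} a b c a' b' c'.
rewrite !F_vec3 => -[a0 ab c0] [a0' ab' c0'] /matrixP E.
have := E 2 0; have := E 1 0; have := E 0 0.
by have [-> | -> | ->] := ord3_cases i; have [-> | -> | ->] := ord3_cases j;
  rewrite /= !vec3E => E0 E1 E2; (split=> //; congr vec3; lia) || (exfalso; lia).
Qed.

(** At [(1, 7, 5)] the form [3 x_2 - 4 x_3] equals the first coordinate, the borderline that no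
    image of [F] attains. *)
Lemma N_F_base (i : 'I_3) (x : 'cV[int]_3) : F x -> N i *m x <> vec3 1 7 5.
Proof.
rewrite (vec3_eta _ x) N_mulZ.
move: (x 0 0) (x 1 0) (x 2 0) => {x} a b c.
rewrite !F_vec3 => -[a0 ab c0] /matrixP E.
have := E 2 0; have := E 1 0; have := E 0 0.
by have [-> | -> | ->] := ord3_cases i; rewrite /= !vec3E; lia.
Qed.

(* The sign of b' = 3b - 4c and its position with respect to a tell which N_i^-1 leads back to F;
   b' = a forces (1, 7, 5), and b' = 0 would make a, b, c all even. *)
Lemma primitive_solutions_descent (x : 'cV[int]_3) : primitive_solutions F x ->
  x = vec3 1 7 5 \/
  exists i y, [/\ primitive_solutions F y, N i *m y = x & y 2 0 < x 2 0].
Proof.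
case; rewrite (vec3_eta _ x); move: (x 0 0) (x 1 0) (x 2 0) => {x} a b c.
move=> q p; rewrite F_vec3 => -[a0 ab c0].
have step i u v w : N i *m vec3 u v w = vec3 a b c -> F (vec3 u v w) -> w < c ->
    exists i y, [/\ primitive_solutions F y, N i *m y = vec3 a b c
                  & y 2 0 < vec3 a b c 2 0].
  move=> e f wc; exists i, (vec3 u v w); split; [split=> // | by [] | by rewrite !vec3E].
    by rewrite -(N_Q _ i) -q -e; congr (Q (_ *m _)); apply/matrixP => k j; rewrite mxE intz.
  by apply/(primitive_N i); rewrite e.
have {q} q : a ^+ 2 + b ^+ 2 = 2 * c ^+ 2 by move: q; rewrite Q_vec3 => /subr0_eq.
have c'0 : 0 < 3 * c - 2 * b by nia.
have cb : c < b by nia.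
have [b'0|b'0|b'0] := ltgtP (3 * b - 4 * c) 0.
- right; apply: (step 0 (4 * c - 3 * b) a (3 * c - 2 * b)); last by lia.
    by rewrite N_mulZ /=; congr vec3; ring.
  by apply/F_vec3; split=> //; nia.
- have [b'a|b'a|b'a] := ltgtP (3 * b - 4 * c) a.
  + right; apply: (step 1 (3 * b - 4 * c) a (3 * c - 2 * b)); last by lia.
      by rewrite N_mulZ /=; congr vec3; ring.
    by apply/F_vec3; split=> //; nia.
  + right; apply: (step 2 a (3 * b - 4 * c) (3 * c - 2 * b)); last by lia.
      by rewrite N_mulZ /=; congr vec3; ring.
    by apply/F_vec3; split=> //; nia.
  (* Putting [4c = 3b - a] into the equation gives [(b - 7a)(b + a) = 0]. *)
  + left; have b7 : b = 7 * a by nia.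
    have c5 : c = 5 * a by lia.
    have a1 : a <= 1.
      by apply: (primitive_vec3 a b c).1 => //; rewrite ?b7 ?c5 dvdz_mull.
    by congr vec3; lia.
- exfalso; pose k := b - c.
  have [bk ck] : b = 4 * k /\ c = 3 * k by rewrite /k; lia.
  (* The equation reads [a^2 + 16k^2 = 18k^2]; hence [a] is even, and then [k] is even too. *)
  have ak : a ^+ 2 = 2 * k ^+ 2 by nia.
  have [m am] : exists m, a = 2 * m by exists (a %/ 2)%Z; nia.
  have [l kl] : exists l, k = 2 * l by exists (k %/ 2)%Z; nia.
  suff : (2 : int) <= 1 by [].
  have [b2 c2] : b = 2 * (2 * k) /\ c = 2 * (3 * l) by lia.
  by apply: (primitive_vec3 a b c).1 => //; rewrite ?am ?b2 ?c2 dvdz_mulr.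
Qed.

Lemma generated_cons (i : 'I_3) (w : seq 'I_3) (b : 'cV[int]_3) :
  generated N (i :: w, b) = N i *m generated N (w, b).
Proof. by rewrite /generated/= big_cons mulmxA. Qed.

Lemma generated_nil (b : 'cV[int]_3) : generated N ([::], b) = b.
Proof. by rewrite /generated/= big_nil mul1mx. Qed.

Lemma primitive_solutions_base : primitive_solutions F (vec3 1 7 5).
Proof.
split; [by rewrite Q_vec3 | | exact/F_vec3].
by apply/primitive_vec3 => d; rewrite dvdz1 => /eqP d1 _ _; lia.
Qed.

Lemma generated_primitive (w : seq 'I_3) :
  primitive_solutions F (generated N (w, vec3 1 7 5)).
Proof.
elim: w => [|i w IH]; first by rewrite generated_nil; exact: primitive_solutions_base.
by rewrite generated_cons; exact: primitive_solutions_N.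
Qed.

Lemma generated_surj (x : 'cV[int]_3) :
  primitive_solutions F x -> exists w, generated N (w, vec3 1 7 5) = x.
Proof.
have [n] := ubnP (absz (x 2 0)); elim: n x => // n IH x xn xF.
have [->|[i [y [yF e yx]]]] := primitive_solutions_descent _ xF.
  by exists [::]; rewrite generated_nil.
have [|w ew] := IH y _ yF; last by exists (i :: w); rewrite generated_cons ew.
by case: xF yF => _ _ [_ _ x0] [_ _ [_ _ y0]]; lia.
Qed.

(** The words are compared from the left: [N_F_inj] strips equal first matrices, and [N_F_base]
    rules out that one word ends before the other. *)
Lemma generated_inj (w v : seq 'I_3) :
  generated N (w, vec3 1 7 5) = generated N (v, vec3 1 7 5) -> w = v.
Proof.
have gF u : F (generated N (u, vec3 1 7 5)) by case: (generated_primitive u).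
elim: w v => [|i w IH] [|j v] //; rewrite ?generated_cons ?generated_nil.
- by move/esym/N_F_base => /(_ (gF _)).
- by move/N_F_base => /(_ (gF _)).
- by move=> /N_F_inj[]// -> /IH ->.
Qed.

Lemma matrix_generating_system_N : matrix_generating_system N [:: vec3 1 7 5] F.
Proof.
split.
  apply/seteqP; split=> [_ [[w b]/= + <-]|x /generated_surj[w e]].
    by rewrite inE => /eqP ->; exact: generated_primitive.
  by exists (w, vec3 1 7 5); rewrite /= ?inE.
move=> x /generated_surj[w e]; exists (w, vec3 1 7 5); split.
  by rewrite inE.
move=> [v b] /= []; rewrite inE => /eqP -> ev.
by rewrite (generated_inj w v) // e ev.
Qed.

(** * The circle and the conjugacy *)

Section Circle.
Context {R : realType}.
Implicit Types (t y : R) (p q : R * R).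

Lemma sqrt2_gt0 : 0 < sqrt2 :> R.
Proof. by rewrite sqrtr_gt0. Qed.

Lemma sqr_sqrt2 : sqrt2 * sqrt2 = 2 :> R.
Proof. by rewrite -expr2 sqr_sqrtr. Qed.

Lemma sqrt2_itv : 1 < (sqrt2 : R) < 2.
Proof. by have := sqrt2_gt0; have := sqr_sqrt2 => *; apply/andP; split; nra. Qed.

Lemma FA_def p : FA p <-> p.1 ^+ 2 + p.2 ^+ 2 = 2 /\ 0 < p.1 < p.2.
Proof.
rewrite /FA/arcE/= Q_vec3 expr1n mulr1.
by split=> -[e lt]; split=> //; apply/eqP; move/eqP: e; rewrite subr_eq0.
Qed.

(* The other intersection point of the circle with the line of slope 1 + t through (-1, -1). *)
Definition arc_of t : R * R :=
  ((2 - t ^+ 2) / (t ^+ 2 + 2 * t + 2), (t ^+ 2 + 4 * t + 2) / (t ^+ 2 + 2 * t + 2)).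

Lemma arc_of_FA t : 0 < t < sqrt2 -> FA (arc_of t).
Proof.
move=> /andP[t0 ts]; apply/FA_def; rewrite /arc_of/=.
have := sqr_sqrt2 => ss.
have d0 : 0 < t ^+ 2 + 2 * t + 2 by nra.
split; first by field; rewrite gt_eqF.
by rewrite divr_gt0 ?ltr_pM2r ?invr_gt0//=; nra.
Qed.

Lemma conj_map_itv p : FA p -> 0 < conj_map p < sqrt2.
Proof.
move/FA_def; case: p => x y /= [e /andP[x0 xy]]; rewrite /conj_map/=.
have ss := sqr_sqrt2; have s0 := sqrt2_gt0.
have ys : y < sqrt2.
  rewrite ltNge; apply/negP => sy.
  have xx : 0 < x * x by rewrite mulr_gt0.
  nra.
have x10 : 0 < x + 1 by lra.
have sx : 0 < x * sqrt2 by rewrite mulr_gt0.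
by rewrite divr_gt0 ?ltr_pdivrMr ?subr_gt0//=; lra.
Qed.

Lemma arc_ofK t : 0 < t < sqrt2 -> conj_map (arc_of t) = t.
Proof.
move=> /andP[t0 ts]; rewrite /conj_map /arc_of/=.
have d0 : 0 < t ^+ 2 + 2 * t + 2 by nra.
by field; rewrite !gt_eqF//; nra.
Qed.

Lemma conj_mapK p : FA p -> arc_of (conj_map p) = p.
Proof.
move/FA_def; case: p => x y /= [e /andP[x0 xy]]; rewrite /arc_of /conj_map/=.
have u0 : 0 < (y - x) / (x + 1) by apply: divr_gt0; lra.
have hu : (y - x) / (x + 1) * (x + 1) = y - x by rewrite divfK// gt_eqF//; lra.
move: (_ / _) u0 hu => u u0 hu.
have d0 : 0 < u ^+ 2 + 2 * u + 2 by nra.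
have x1 : (x + 1) ^+ 2 != 0 by rewrite expf_neq0// gt_eqF//; lra.
(* The goals below are cubic in [x] and [y]; with the circle equation multiplied by [x] and by [y],
   they become linear in the monomials. *)
have ex := congr1 (fun z => x * z) e; have ey := congr1 (fun z => y * z) e.
have hu2 : (x + 1) ^+ 2 * u ^+ 2 = (y - x) ^+ 2 by rewrite -hu; ring.
have dn0 : u ^+ 2 + 2 * u + 2 != 0 by rewrite gt_eqF.
congr pair; apply: (canLR (mulfK dn0)); apply: (mulfI x1).
  rewrite mulrBr hu2; rewrite [RHS](_ : _ = x * ((y - x) ^+ 2 + 2 * (y - x) * (x + 1) + 2 * (x + 1) ^+ 2)).
    by move=> /=; lra.
  by rewrite -hu2 -hu; ring.
rewrite [LHS](_ : _ = (y - x) ^+ 2 + 4 * (y - x) * (x + 1) + 2 * (x + 1) ^+ 2); last first.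
  by rewrite -hu2 -hu; ring.
rewrite [RHS](_ : _ = y * ((y - x) ^+ 2 + 2 * (y - x) * (x + 1) + 2 * (x + 1) ^+ 2)).
  by move=> /=; lra.
by rewrite -hu2 -hu; ring.
Qed.

Lemma realmx_mul (i : 'I_3) p :
  Defs.realmx (N i) *m vec3 p.1 p.2 1 =
  nth (vec3 p.1 (3 * p.2 + 4) (2 * p.2 + 3))
    [:: vec3 p.2 (4 - 3 * p.1) (3 - 2 * p.1);
        vec3 p.2 (3 * p.1 + 4) (2 * p.1 + 3)] i :> 'cV[R]_3.
Proof. by rewrite N_mul !mulr1. Qed.

Lemma hat_N (i : 'I_3) p :
  hat (Defs.realmx (N i)) p =
  nth (p.1 / (2 * p.2 + 3), (3 * p.2 + 4) / (2 * p.2 + 3))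
    [:: (p.2 / (3 - 2 * p.1), (4 - 3 * p.1) / (3 - 2 * p.1));
        (p.2 / (2 * p.1 + 3), (3 * p.1 + 4) / (2 * p.1 + 3))] i.
Proof.
by rewrite /hat realmx_mul; have [-> | -> | ->] := ord3_cases i; rewrite /= !vec3E.
Qed.

Lemma unitmx_N (i : 'I_3) : Defs.realmx (N i) \in unitmx (R := R).
Proof.
pose M : 'M[R]_3 := nth (mat3 (vec3 1 0 0) (vec3 0 3 (-4)) (vec3 0 (-2) 3))
  [:: mat3 (vec3 0 (-3) 4) (vec3 1 0 0) (vec3 0 (-2) 3);
      mat3 (vec3 0 3 (-4)) (vec3 1 0 0) (vec3 0 (-2) 3)] i.
suff /mulmx1_unit[] : Defs.realmx (N i) *m M = 1%:M by [].
apply/matrixP => k j.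
by rewrite /M; have [-> | -> | ->] := ord3_cases i; have [-> | -> | ->] := ord3_cases k;
  have [-> | -> | ->] := ord3_cases j;
  rewrite !mxE !big_ord_recr big_ord0 /= !mxE /=; ring.
Qed.

(** The action is projective: dividing by the third coordinate rescales the vector, and the scalar
    cancels in the quotients that define [hat]. *)
Lemma hat_invmx (A : 'M[R]_3) p : A \in unitmx ->
  (A *m vec3 p.1 p.2 1) 2 0 != 0 -> hat (invmx A) (hat A p) = p.
Proof.
move=> uA; rewrite [hat A p]/hat; set v := A *m _ => v0.
have e (w : 'cV[R]_3) : w 2 0 != 0 ->
    vec3 (w 0 0 / w 2 0) (w 1 0 / w 2 0) 1 = (w 2 0)^-1 *: w.
  move=> w0; rewrite [RHS]vec3_eta !mxE mulVf//.
  by congr vec3; exact: mulrC.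
rewrite /hat/= e// -scalemxAr mulKmx//.
move: (v 2 0) v0 => c c0 {v e}; rewrite !mxE /= mulr1 invrK.
by rewrite 2!(mulrC c^-1) !mulfVK//; case: p.
Qed.

End Circle.

(** * The inverse branches and the map on the arc *)

Section System.
Context {R : realType}.
Implicit Types (t y : R) (p q : R * R).

Lemma FA_bounds p : FA p -> [/\ 0 < p.1, p.1 < 1, 1 < p.2 & p.2 < 3 / 2].
Proof. by move/FA_def => [e /andP[p0 p12]]; split=> //; nra. Qed.

Lemma FA_denom (i : 'I_3) p : FA p ->
  0 < nth (2 * p.2 + 3) [:: 3 - 2 * p.1; 2 * p.1 + 3] i.
Proof. by move/FA_bounds => [? ? ? ?]; have [-> | -> | ->] := ord3_cases i => /=; lra. Qed.

(* Up to sign 3x_2 - 4x_3 is a coordinate of N_i^-1 x; here it is read on the chart x_3 = 1. *)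
Lemma hat_N_separation (i : 'I_3) q p : FA q -> hat (Defs.realmx (N i)) q = p ->
  nth (p.1 < 3 * p.2 - 4) [:: 3 * p.2 - 4 < 0; 0 < 3 * p.2 - 4 < p.1] i.
Proof.
move=> qF; have d0 := FA_denom i _ qF; have [q1 q1' q2 q2'] := FA_bounds _ qF.
have /FA_def[_ /andP[_ q12]] := qF.
rewrite hat_N => <-; move: d0; have [-> | -> | ->] := ord3_cases i => /= d0.
- rewrite (_ : _ - 4 = - q.1 / (3 - 2 * q.1)); last by field; rewrite gt_eqF.
  by rewrite mulNr oppr_lt0 divr_gt0.
- rewrite (_ : _ - 4 = q.1 / (2 * q.1 + 3)); last by field; rewrite gt_eqF.
  by rewrite divr_gt0//= ltr_pM2r ?invr_gt0.
- rewrite (_ : _ - 4 = q.2 / (2 * q.2 + 3)); last by field; rewrite gt_eqF.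
  by rewrite ltr_pM2r ?invr_gt0.
Qed.

Lemma trivIset_arcD : trivIset setT (arcD (R := R) N).
Proof.
move=> i j _ _ [p [[/FA_bounds[p0 _ _ _] [q qF e]] [_ [q' q'F e']]]].
have := hat_N_separation i _ _ qF e; have := hat_N_separation j _ _ q'F e'.
move: p.1 p.2 p0 => {qF q'F e e'} a b a0.
by have [-> | -> | ->] := ord3_cases i; have [-> | -> | ->] := ord3_cases j => //= s' s;
  exfalso; try move/andP: s => [? ?]; try move/andP: s' => [? ?]; lra.
Qed.

Lemma hatT_N (i : 'I_3) q : FA q -> FA (hat (Defs.realmx (N i)) q) ->
  hatT_dom N (hat (Defs.realmx (N i)) q) /\
  hatT N (hat (Defs.realmx (N i)) q) = q.
Proof.
move=> qF pF; have Di : arcD N i (hat (Defs.realmx (N i)) q) by split=> //; exists q.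
split; first by exists i.
rewrite /hatT; case: pickP => [j /asboolP Dj|/(_ i)]; last by move/asboolP.
(* [pick] could return another index; disjointness of the arcs forces it to be [i]. *)
have -> : j = i by apply: (trivIset_arcD j i) => //; exists (hat (Defs.realmx (N i)) q).
apply: hat_invmx; first exact: unitmx_N.
have := FA_denom i _ qF; rewrite realmx_mul.
by have [-> | -> | ->] := ord3_cases i; rewrite /= vec3E => /gt_eqF ->.
Qed.

Definition branch (i : 'I_3) y : R :=
  nth ((2 * y + 2) / (y + 2)) [:: y / (y + 1); 2 / (y + 2)] i.

(** The conjugacy, read on inverse branches: in the slope coordinate the projective action of [N i]
    on the circle is a Möbius map. *)
Lemma arc_of_branch (i : 'I_3) y : 0 < y ->
  arc_of (branch i y) = hat (Defs.realmx (N i)) (arc_of y).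
Proof.
move=> y0; rewrite hat_N /branch.
have yy : 0 < y * y by rewrite mulr_gt0.
have [-> | -> | ->] := ord3_cases i; rewrite /= /arc_of/=; congr pair;
  by field; rewrite !gt_eqF//; nra.
Qed.

Definition cut : R := sqrt2 / (1 + sqrt2).

Lemma cutE : cut = 2 - sqrt2.
Proof.
have s := sqr_sqrt2 (R := R); have /andP[s1 s2] := sqrt2_itv (R := R).
by apply: (canLR (mulfK _)); [rewrite gt_eqF//; lra|lra].
Qed.

Lemma T3_domP t : T3_dom t <->
  [\/ 0 < t < cut, cut < t < 1 | 1 < t < sqrt2].
Proof.
rewrite /T3_dom -/cut /= !in_itv/=.
split=> [[[]|]|[]]; by [apply: Or31|apply: Or32|apply: Or33|left;left|left;right|right].
Qed.

Definition branch_itv (i : 'I_3) : interval R :=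
  nth (`]1, sqrt2[) [:: `]0, cut[; `]cut, 1[] i.

Lemma branchK (i : 'I_3) t : t \in branch_itv i ->
  0 < T3 t < sqrt2 /\ branch i (T3 t) = t.
Proof.
have s := sqr_sqrt2 (R := R); have /andP[s1 s2] := sqrt2_itv (R := R).
have c := cutE.
rewrite /branch_itv /T3 -/cut /branch.
have [-> | -> | ->] := ord3_cases i; rewrite /= in_itv/= => /andP[ta tb].
- rewrite tb; split; last by field; rewrite !gt_eqF//; lra.
  by rewrite divr_gt0 ?ltr_pdivrMr//=; nra.
- rewrite (ltNge t cut) (ltW ta) /= tb; split; last by field; rewrite !gt_eqF//; lra.
  by rewrite divr_gt0 ?ltr_pdivrMr//=; nra.
- have ca : cut < t by lra.
  rewrite (ltNge t cut) (ltNge t 1) (ltW ta) (ltW ca) /=.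
  split; last by field; rewrite !gt_eqF//; lra.
  by rewrite divr_gt0 ?ltr_pdivrMr//=; nra.
Qed.

Lemma branch_mem (i : 'I_3) y : 0 < y < sqrt2 ->
  branch i y \in branch_itv i /\ T3 (branch i y) = y.
Proof.
have s := sqr_sqrt2 (R := R); have /andP[s1 s2] := sqrt2_itv (R := R).
have c := cutE.
move=> /andP[y0 ys].
(* The endpoint [sqrt2] is sent to [cut], [cut], [sqrt2] by the branches 0, 1, 2. With denominators
   cleared, [h1] is the resulting bound for branch 0 and [h2] the one for branches 1 and 2. *)
have h1 : 0 < (sqrt2 - y) * (sqrt2 - 1) by rewrite mulr_gt0 ?subr_gt0.
have h2 : 0 < (sqrt2 - y) * (2 - sqrt2) by rewrite mulr_gt0 ?subr_gt0.
have bi : branch i y \in branch_itv i.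
  rewrite /branch_itv /branch; have [-> | -> | ->] := ord3_cases i;
    rewrite /= in_itv/= ?c; apply/andP; split;
    rewrite ?divr_gt0 ?ltr_pdivrMr ?ltr_pdivlMr//; nra.
split=> //; move: bi; rewrite /branch_itv /branch /T3 -/cut.
have [-> | -> | ->] := ord3_cases i; rewrite /= in_itv/= => /andP[ta tb].
- by rewrite tb; field; rewrite !gt_eqF//; lra.
- by rewrite ltNge (ltW ta) /= tb; field; rewrite !gt_eqF//; lra.
- have ca : cut < (2 * y + 2) / (y + 2) by lra.
  rewrite (ltNge _ cut) (ltNge _ 1) (ltW ta) (ltW ca) /=.
  by field; rewrite !gt_eqF//; lra.
Qed.

Lemma T3_domE t : T3_dom t <-> exists i, t \in branch_itv i.
Proof.
rewrite T3_domP; split=> [[] h|[i]]; rewrite /branch_itv.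
- by exists 0; rewrite in_itv.
- by exists 1; rewrite in_itv.
- by exists 2; rewrite in_itv.
by have [-> | -> | ->] := ord3_cases i; rewrite in_itv/= => h; [apply: Or31|apply: Or32|apply: Or33].
Qed.

End System.

Section SystemUnder.
Context {R : realType}.
Implicit Types (t y : R) (p q : R * R).

Lemma T3_dom_itv : T3_dom `<=` `]0, (sqrt2 : R)[.
Proof.
have /andP[s1 s2] := sqrt2_itv (R := R); have c := cutE (R := R).
by move=> t /T3_domP[] /andP[t1 t2]; rewrite /= in_itv/=; apply/andP; split; lra.
Qed.

Lemma itv_T3_dom t : 0 < t < sqrt2 -> t <> cut -> t <> 1 -> T3_dom t.
Proof.
move=> /andP[t0 ts] /eqP tc /eqP t1; apply/T3_domP.
case/lt_total/orP: tc => tc'; first by apply: Or31; rewrite t0 tc'.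
case/lt_total/orP: t1 => t1'; first by apply: Or32; rewrite tc' t1'.
by apply: Or33; rewrite t1' ts.
Qed.

Lemma finite_T3_undefined : finite_set (`]0, (sqrt2 : R)[ `\` T3_dom).
Proof.
apply: (@sub_finite_set _ _ [set cut; 1]); last exact: finite_set2.
move=> t [/=]; rewrite in_itv/= => t0 nD.
have [->|tc] := pselect (t = cut); first by left.
have [->|t1] := pselect (t = 1); first by right.
by case: nD; exact: itv_T3_dom.
Qed.

(** A point [t] of the piece [i] is [branch i (T3 t)], so [arc_of t] is the image of [arc_of (T3 t)]
    under [N i], and [hatT] undoes this matrix. *)
Lemma hatT_arc_of t : T3_dom t ->
  hatT_dom N (arc_of t) /\ hatT N (arc_of t) = arc_of (T3 t).
Proof.
move=> tD; have := T3_dom_itv _ tD; rewrite /= in_itv/= => t0.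
have /T3_domE[i ti] := tD; have [y0 e] := branchK i t ti.
have ae : arc_of t = hat (Defs.realmx (N i)) (arc_of (T3 t)).
  by rewrite -arc_of_branch ?e//; case/andP: y0.
by rewrite {1 2}ae; apply: hatT_N; [exact: arc_of_FA|rewrite -ae; exact: arc_of_FA].
Qed.

Lemma continuous_conj_map : {within FA, continuous (@conj_map R)}.
Proof.
apply: continuous_in_subspaceT => p /set_mem/FA_bounds[p1 _ _ _].
apply: cvgM; first by apply: cvgB; [exact: cvg_snd|exact: cvg_fst].
apply: cvgV; first by rewrite gt_eqF// addr_gt0.
by apply: cvgD; [exact: cvg_fst|exact: cvg_cst].
Qed.

Lemma continuous_arc_of : {within `]0, (sqrt2 : R)[, continuous arc_of}.
Proof.
apply: continuous_in_subspaceT => t /set_mem/=; rewrite in_itv/= => /andP[t0 _].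
have sqr : (fun s : R => s ^+ 2) @ t --> t ^+ 2 by exact: exprn_continuous.
have lin (c : R) : (fun s : R => c * s) @ t --> c * t.
  by apply: cvgM; [exact: cvg_cst|exact: cvg_id].
have den : (fun s : R => (s ^+ 2 + 2 * s + 2)^-1) @ t --> (t ^+ 2 + 2 * t + 2)^-1.
  apply: cvgV; last by apply: cvgD; [exact: cvgD|exact: cvg_cst].
  by rewrite gt_eqF// !addr_gt0// ?exprn_gt0// mulr_gt0.
have fst_cvg : (fun s => (arc_of s).1) @ t --> (arc_of t).1.
  by apply: cvgM => //; apply: cvgB => //; exact: cvg_cst.
have snd_cvg : (fun s => (arc_of s).2) @ t --> (arc_of t).2.
  by apply: cvgM => //; apply: cvgD; [exact: cvgD|exact: cvg_cst].
exact: (cvg_pair fst_cvg snd_cvg).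
Qed.

Lemma is_system_under_T3 :
  is_system_under N (@conj_map R) `]0, sqrt2[ T3_dom T3.
Proof.
have gF t : `]0, sqrt2[%classic t -> FA (arc_of t).
  by rewrite /= in_itv/=; exact: arc_of_FA.
have swd : system_well_defined (R := R) N.
  split; [by move=> i x; exact: N_Q|exact: trivIset_arcD|].
  apply: (@sub_finite_set _ _ (arc_of @` (`]0, (sqrt2 : R)[ `\` T3_dom))).
    move=> p [pF nD]; exists (conj_map p); last exact: conj_mapK.
    split; first by rewrite /= in_itv/=; exact: conj_map_itv.
    by move=> /hatT_arc_of[]; rewrite conj_mapK.
  exact/finite_image/finite_T3_undefined.
split; [exact: swd|exact: T3_dom_itv|exact: finite_T3_undefined|].
exists arc_of; split.
  split; [|exact: gF| |exact: continuous_conj_map|exact: continuous_arc_of].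
  - split.
    + by move=> p /conj_map_itv; rewrite /= in_itv.
    + by move=> p q /set_mem pF /set_mem qF e; rewrite -(conj_mapK p)// e conj_mapK.
    + move=> t tB; exists (arc_of t); first exact: gF.
      by apply: arc_ofK; move: tB; rewrite /= in_itv.
  - by move=> t; rewrite /= in_itv; exact: arc_ofK.
exists (`]0, sqrt2[ `\` T3_dom); split; first exact: finite_T3_undefined.
move=> t tB nS; have tD : T3_dom t by apply: contrapT => nD; exact: nS.
have [d e] := hatT_arc_of t tD; split=> //.
have /T3_domE[i ti] := tD; have [y0 _] := branchK i t ti.
by rewrite e arc_ofK.
Qed.

End SystemUnder.

(** * Invariance of dt/t *)

Section InvariantMeasure.
Context {R : realType}.
Local Notation leb := (@lebesgue_measure R).
Implicit Types (t y : R) (A : set (measurableTypeR R)).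

Lemma measurable_invr : measurable_fun setT (fun x : R => x^-1).
Proof.
rewrite (_ : setT = [set~ 0] `|` [set 0]); last by rewrite setUC setUv.
apply/measurable_funU => //; first exact: measurableC.
split; last exact: measurable_fun_set1.
apply: open_continuous_measurable_fun; first exact: closed_openC.
by move=> x /set_mem/= /eqP x0; exact: inv_continuous.
Qed.

Lemma measurable_T3 : measurable_fun setT (@T3 R).
Proof.
have mlin (a b : R) : measurable_fun setT (fun t : R => a * t + b).
  by apply: measurable_funD => //; exact: measurable_funM.
have mmob (a b c d : R) : measurable_fun setT (fun t : R => (a * t + b) / (c * t + d)).
  by apply: measurable_funM => //; exact: (measurableT_comp measurable_invr).
apply: measurable_fun_ifT; first exact: measurable_fun_ltr.
  by have := mmob 1 0 (-1) 1; congr measurable_fun; apply/funext => t; congr (_ / _); ring.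
apply: measurable_fun_ifT; first exact: measurable_fun_ltr.
  by have := mmob (-2) 2 1 0; congr measurable_fun; apply/funext => t; congr (_ / _); ring.
by have := mmob 2 (-2) (-1) 2; congr measurable_fun; apply/funext => t; congr (_ / _); ring.
Qed.

Lemma measurable_T3_dom : measurable (T3_dom : set (measurableTypeR R)).
Proof. by apply: measurableU; [apply: measurableU|]. Qed.

Lemma inv_succn_lt (e : R) : 0 < e -> exists n, n.+1%:R^-1 < e.
Proof.
move=> e0; exists (Num.bound e^-1); rewrite invf_plt ?posrE//.
apply: lt_le_trans (_ : (Num.bound e^-1)%:R <= _); last by rewrite ler_nat.
by rewrite archi_boundP// invr_ge0 ltW.
Qed.

(** The measures may be infinite near [l] and [h]. Uniqueness on the pi-system of half-open
    intervals is therefore applied to their restrictions to the truncations [D n], and continuity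
    from below passes to [A]. *)
Lemma measure_eq_itv (m1 m2 : {measure set (measurableTypeR R) -> \bar R}) (l h : R) :
  (forall a b, l < a -> a < b -> b < h ->
    m1 `]a, b]%classic = m2 `]a, b]%classic /\ (m1 `]a, b]%classic < +oo)%E) ->
  forall A, measurable A -> A `<=` `]l, h[ -> m1 A = m2 A.
Proof.
move=> m12 A mA Alh.
pose D n : set (measurableTypeR R) := `]l + n.+1%:R^-1, h - n.+1%:R^-1]%classic.
have mD n : measurable (D n) by exact: measurable_itv.
have lD n : 0 < n.+1%:R^-1 :> R by rewrite invr_gt0.
have DE n : m1 (A `&` D n) = m2 (A `&` D n).
  have tr (a b : R) : m1 (`]a, b]%classic `&` D n) = m2 (`]a, b]%classic `&` D n) /\
      (m1 (`]a, b]%classic `&` D n) < +oo)%E.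
    pose a' := Num.max a (l + n.+1%:R^-1); pose b' := Num.min b (h - n.+1%:R^-1).
    have -> : `]a, b]%classic `&` D n = `]a', b']%classic.
      apply/seteqP; split=> t; rewrite /D /= !in_itv/= gt_max le_min.
        by move=> [/andP[-> ->] /andP[-> ->]].
      by move=> /andP[/andP[-> ->] /andP[-> ->]].
    have [a'b'|b'a'] := ltP a' b'; last first.
      by rewrite set_itv_ge ?bnd_simp -?leNgt// !measure0.
    apply: m12 => //; have := lD n; rewrite /a' /b'.
      by rewrite lt_max ltrDl => ->; rewrite orbT.
    by rewrite gt_min gtrBl => ->; rewrite orbT.
  have := @measure_unique _ R (measurableTypeR R) (@ocitv R)
    (fun k => `](- k%:R), k%:R]%classic) erefl (@ocitvI R) (fun=> is_ocitv _ _)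
    (bigcup_itvT _ _) (mrestr m1 (mD n)) (mrestr m2 (mD n)) _ _.
  apply.
  - by move=> _ [[a b] _ <-]; have [] := tr a b.
  - by move=> k; have [] := tr (- k%:R) k%:R.
  - exact: mA.
have ex t : l < t < h -> exists n, D n t.
  move=> /andP[lt th]; pose e := Num.min (t - l) (h - t).
  have e0 : 0 < e by rewrite lt_min !subr_gt0 lt th.
  have [n ne] := inv_succn_lt _ e0.
  exists n; move: ne; rewrite /D /e lt_min /= in_itv/= => /andP[ne1 ne2].
  by rewrite addrC -ltrBrDr ne1 /= lerBrDr addrC -lerBrDr ltW.
have AD : A = \bigcup_n (A `&` D n).
  rewrite -setI_bigcupr; apply/seteqP; split=> [t tA|t []//]; split=> //.
  by have [|n tn] := ex t; [have := Alh t tA; rewrite /= in_itv|exists n].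
have ndD : nondecreasing_seq (fun n => A `&` D n).
  move=> i j ij; apply/subsetPset; apply: setIS => t; rewrite /D /= !in_itv/=.
  have ji : j.+1%:R^-1 <= i.+1%:R^-1 :> R by rewrite lef_pV2 ?posrE// ler_nat.
  move=> /andP[t1 t2]; rewrite (le_lt_trans _ t1) ?lerD2l//=.
  by rewrite (le_trans t2)// lerD2l lerN2.
rewrite AD; transitivity (limn (fun n => m1 (A `&` D n))).
  apply/esym/cvg_lim => //.
  by apply: nondecreasing_cvg_mu => //; [move=> n; exact: measurableI|rewrite -AD].
under eq_fun do rewrite DE.
apply/cvg_lim => //.
by apply: nondecreasing_cvg_mu => //; [move=> n; exact: measurableI|rewrite -AD].
Qed.

Lemma mu_inv_itv (a b : R) (x y : bool) : 0 < a -> a < b -> b < sqrt2 ->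
  mu_inv [set` Interval (BSide x a) (BSide y b)] = (ln b - ln a)%:E.
Proof.
move=> a0 ab bs; have pos z : a <= z -> 0 < z by exact: lt_le_trans.
have der z : 0 < z -> derivable (@ln R) z 1 by move=> z0; apply: ex_derive; exact: is_derive1_ln.
rewrite /mu_inv setIidl; last first.
  by move=> z /=; rewrite !in_itv/=; case: x; case: y => /= /andP[az zb];
    apply/andP; split; lra.
have minv : measurable_fun `]a, b[ (fun z : R => (z^-1)%:E).
  by apply: measurable_funTS; apply/measurable_EFinP; exact: measurable_invr.
(* Endpoints are null: the interval is opened and then closed, the form in which the fundamental
   theorem of calculus applies. *)
rewrite integral_itv_bndoo// -(integral_itv_bndoo true false)//.
rewrite (@continuous_FTC2 _ (fun z => z^-1) (@ln R))// ?EFinB//.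
- apply: continuous_in_subspaceT => z /set_mem/=; rewrite in_itv/= => /andP[az _].
  by apply: inv_continuous; rewrite gt_eqF// pos.
- split.
  + by move=> z; rewrite in_itv/= => /andP[/ltW/pos z0 _]; exact: der.
  + by apply: cvg_at_right_filter; exact: continuous_ln.
  + by apply: cvg_at_left_filter; apply: continuous_ln; exact: lt_trans ab.
- move=> z; rewrite in_itv/= => /andP[/ltW/pos z0 _].
  by rewrite derive1E; have [_ ->] := is_derive1_ln z0.
Qed.

End InvariantMeasure.

Section Invariance.
Context {R : realType}.
Local Notation leb := (@lebesgue_measure R).
Local Notation B := (`]0, (sqrt2 : R)[%classic : set (measurableTypeR R)).
Implicit Types (t y : R) (A : set (measurableTypeR R)).

Lemma measurable_inv_EFin (D : set (measurableTypeR R)) :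
  measurable_fun D (fun t : R => (t^-1)%:E).
Proof. by apply: measurable_funTS; apply/measurable_EFinP; exact: measurable_invr. Qed.

Lemma leb_B : leb B = sqrt2%:E.
Proof. by rewrite lebesgue_measure_itv/= lte_fin sqrt2_gt0 sube0. Qed.

Lemma leb_B_lty A : measurable A -> A `<=` B -> (leb A <= sqrt2%:E)%E.
Proof. by move=> mA AB; rewrite -leb_B le_measure ?inE//; exact: measurable_itv. Qed.

Lemma mu_inv_le (a : R) A : 0 < a -> measurable A -> A `<=` `[a, +oo[ ->
  (mu_inv A <= (a^-1 * sqrt2)%:E)%E.
Proof.
move=> a0 mA Aa; have mAB : measurable (A `&` B) by exact: measurableI.
apply: (@le_trans _ _ (\int[leb]_(t in A `&` B) (a^-1)%:E)%E).
  apply: ge0_le_integral => //.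
  - by move=> t [_ /=]; rewrite in_itv/= => /andP[t0 _]; rewrite lee_fin invr_ge0 ltW.
  - exact: measurable_inv_EFin.
  - move=> t [/Aa + /=]; rewrite /= !in_itv/= andbT => ta /andP[t0 _].
    by rewrite lee_fin lef_pV2.
rewrite integral_cst// EFinM lee_pmul2l// ?lte_fin ?invr_gt0//.
by apply: leb_B_lty => // t [].
Qed.

Lemma leb_le_mu_inv A : measurable A -> A `<=` B -> (leb A <= sqrt2%:E * mu_inv A)%E.
Proof.
move=> mA AB; rewrite -lee_pdivrMl ?sqrt2_gt0// /mu_inv setIidl//.
rewrite -[leLHS]integral_cst//; apply: ge0_le_integral => //.
- by move=> t _; rewrite lee_fin invr_ge0 ltW ?sqrt2_gt0.
- exact: measurable_inv_EFin.
- move=> t /AB /=; rewrite in_itv/= => /andP[t0 ts].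
  by rewrite lee_fin lef_pV2 ?posrE ?sqrt2_gt0// ltW.
Qed.

(** [mu_inv] has a density and dominates a multiple of Lebesgue measure on [B]. Null sets can thus
    be moved between the invariant measure and Lebesgue measure. *)
Lemma mu_inv_eq0 A : measurable A -> A `<=` B -> (mu_inv A = 0 <-> leb A = 0)%E.
Proof.
move=> mA AB; split=> [m0|l0].
  by apply/eqP; rewrite eq_le measure_ge0 andbT (le_trans (leb_le_mu_inv _ mA AB))// m0 mule0.
rewrite /mu_inv setIidl//; apply: null_set_integral => //.
exact: measurable_inv_EFin.
Qed.

Lemma measurable_preT A : measurable A -> measurable (T3_dom `&` T3 @^-1` A).
Proof.
move=> mA; apply: measurableI; first exact: measurable_T3_dom.
by rewrite -[X in measurable X]setTI; exact: measurable_T3.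
Qed.

Lemma branch_lt (i : 'I_3) y z : 0 < y -> 0 < z ->
  (branch i y < branch i z) = if i == 1 then z < y else y < z.
Proof.
move=> y0 z0; have [-> | -> | ->] := ord3_cases i; rewrite /branch /=;
  rewrite ltr_pdivrMr ?addr_gt0// mulrAC ltr_pdivlMr ?addr_gt0//;
  by apply/idP/idP; lra.
Qed.

Lemma branch_le (i : 'I_3) y z : 0 < y -> 0 < z ->
  (branch i y <= branch i z) = if i == 1 then z <= y else y <= z.
Proof. by move=> y0 z0; rewrite leNgt branch_lt//; case: ifP => _; rewrite -leNgt. Qed.

(** Branch 1 is decreasing, so it swaps the endpoints and the closed end becomes the left one. *)
Definition branch_image (a b : R) (i : 'I_3) : interval R :=
  if i == 1 then `[branch i b, branch i a[ else `]branch i a, branch i b].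

Lemma branch_imageE (a b : R) (i : 'I_3) y : 0 < a -> 0 < b -> 0 < y ->
  (branch i y \in branch_image a b i) = (a < y <= b).
Proof.
move=> a0 b0 y0; rewrite /branch_image; case: ifP => i1; rewrite in_itv/=.
  by rewrite branch_lt// branch_le// i1 andbC.
by rewrite branch_lt// branch_le// i1.
Qed.

Lemma branch_image_sub (a b t : R) (i : 'I_3) : 0 < a -> a < b -> b < sqrt2 ->
  t \in branch_image a b i -> t \in branch_itv i.
Proof.
move=> a0 ab bs; rewrite /branch_image.
have [|+ _] := branch_mem i a; first by apply/andP; split; lra.
have [|+ _] := branch_mem i b; first by apply/andP; split; lra.
rewrite /branch_itv; have [-> | -> | ->] := ord3_cases i; rewrite /= !in_itv/=;
  move=> /andP[? ?] /andP[? ?] /andP[? ?]; apply/andP; split; lra.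
Qed.

Lemma preT_itvE (a b : R) : 0 < a -> a < b -> b < sqrt2 ->
  T3_dom `&` T3 @^-1` `]a, b]%classic =
  [set` branch_image a b 0] `|` [set` branch_image a b 1] `|` [set` branch_image a b 2].
Proof.
move=> a0 ab bs; have b0 : 0 < b by lra.
apply/seteqP; split=> [t [/T3_domE[i ti]]|t].
  have [/andP[y0 _] e] := branchK i t ti.
  rewrite /= in_itv/= -(branch_imageE a b i)// e.
  by have [-> | -> | ->] := ord3_cases i; [left; left|left; right|right].
have sub (i : 'I_3) : t \in branch_image a b i ->
    (T3_dom `&` T3 @^-1` `]a, b]%classic) t.
  move=> ti; have tb := branch_image_sub _ _ _ _ a0 ab bs ti.
  have [/andP[y0 _] e] := branchK i t tb.
  by split; [apply/T3_domE; exists i|rewrite /= in_itv/= -(branch_imageE a b i)// e].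
by case=> [[]|] /sub.
Qed.

(** The three lengths are the logarithms of [b(a + 1) / (a(b + 1))], [(b + 2) / (a + 2)] and
    [(b + 1)(a + 2) / ((a + 1)(b + 2))], whose product telescopes to [b / a]. *)
Lemma mu_inv_preT_itv (a b : R) : 0 < a -> a < b -> b < sqrt2 ->
  mu_inv (T3_dom `&` T3 @^-1` `]a, b]%classic) = mu_inv (`]a, b]%classic : set R).
Proof.
move=> a0 ab bs; have b0 : 0 < b by lra.
have s := sqr_sqrt2 (R := R); have /andP[s1 s2] := sqrt2_itv (R := R).
have c := cutE (R := R).
have J i t : t \in branch_image a b i -> t \in branch_itv i.
  exact: branch_image_sub.
have mJ i : measurable ([set` branch_image a b i] : set (measurableTypeR R)).
  exact: measurable_itv.
have mi (i : 'I_3) : mu_inv [set` branch_image a b i] =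
    (if i == 1 then ln (branch i a) - ln (branch i b)
     else ln (branch i b) - ln (branch i a))%:E.
  have [|+ _] := branch_mem i a; first by apply/andP; split; lra.
  have [|+ _] := branch_mem i b; first by apply/andP; split; lra.
  rewrite /branch_image; case: ifP => i1.
    have ba : branch i b < branch i a by rewrite branch_lt// i1.
    rewrite (eqP i1) /branch_itv /= in ba *; rewrite !in_itv/= => /andP[? ?] /andP[? ?].
    by rewrite mu_inv_itv//; lra.
  have ba : branch i a < branch i b by rewrite branch_lt// i1.
  move=> bI aI; rewrite mu_inv_itv//.
    by move: aI; rewrite /branch_itv; case: (ord3_cases i) => ->; rewrite /= in_itv/= => /andP[? ?]; lra.
  by move: bI; rewrite /branch_itv; case: (ord3_cases i) => ->; rewrite /= in_itv/= => /andP[? ?]; lra.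
rewrite preT_itvE// !measureU//; last 3 first.
- apply/seteqP; split=> t //= [t0 t1]; have := J _ _ t1; have := J _ _ t0.
  by rewrite /branch_itv /= !in_itv/= => /andP[? ?] /andP[? ?]; lra.
- exact: measurableU.
- apply/seteqP; split=> t //= [t0 t1]; have := J _ _ t1.
  by case: t0 => /J; rewrite /branch_itv /= !in_itv/= => /andP[? ?] /andP[? ?]; lra.
transitivity (mu_inv [set` branch_image a b 0%R] + mu_inv [set` branch_image a b 1%R] +
  mu_inv [set` branch_image a b 2%R])%E; first by [].
rewrite !mi mu_inv_itv// -!EFinD /branch /=; congr EFin.
have two y : 2 * y + 2 = 2 * (y + 1) by ring.
rewrite !two !ln_div ?lnM ?posrE ?mulr_gt0 ?addr_gt0//.
ring.
Qed.

Lemma mu_inv_preT A : measurable A -> A `<=` B ->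
  mu_inv (T3_dom `&` T3 @^-1` A) = mu_inv A.
Proof.
move=> mA AB.
(* The preimage measure is a pushforward, to which uniqueness of measures applies; restricting to
   [T3_dom] first discards the points where the value of [T3] is a mere default. *)
have [m2 m2E] : exists m2 : {measure set (measurableTypeR R) -> \bar R},
    forall C, m2 C = mu_inv (T3_dom `&` T3 @^-1` C).
  unshelve eexists (pushforward (mrestr (@mu_inv R) measurable_T3_dom)
    (T3 : measurableTypeR R -> measurableTypeR R)
    : {measure set (measurableTypeR R) -> \bar R}).
    exact: measurable_T3.
  by move=> C; rewrite setIC.
rewrite -m2E; apply/esym; apply: (measure_eq_itv _ m2 0 sqrt2) => // a b a0 ab bs.
have fin : (mu_inv (`]a, b]%classic : set R) < +oo)%E by rewrite mu_inv_itv// ltry.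
by rewrite m2E mu_inv_preT_itv.
Qed.

End Invariance.

(** * Points with a full orbit, and invariance on them *)

Section Iterates.
Context {R : realType}.
Local Notation leb := (@lebesgue_measure R).
Local Notation B := (`]0, (sqrt2 : R)[%classic : set (measurableTypeR R)).
Local Notation X := (all_iterates_defined T3_dom (@T3 R) : set (measurableTypeR R)).
Implicit Types (t y : R) (A : set (measurableTypeR R)).

Lemma iterates_dom t : X t -> T3_dom t.
Proof. by move=> /(_ 0). Qed.

Lemma iterates_T3 t : X t -> X (T3 t).
Proof. by move=> tX n; have := tX n.+1; rewrite iterSr. Qed.

Lemma iterates_iter t n : X t -> X (iter n T3 t).
Proof. by move=> tX; elim: n => //= n; exact: iterates_T3. Qed.

Lemma dom_iterates t : T3_dom t -> X (T3 t) -> X t.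
Proof. by move=> tD tX [|n] //; rewrite iterSr; exact: tX. Qed.

Lemma iterates_itv : X `<=` B.
Proof. by move=> t /iterates_dom/T3_dom_itv. Qed.

Lemma measurable_iter n : measurable_fun setT (iter n (@T3 R)).
Proof.
elim: n => [|n IH]; first exact: measurable_id.
exact: (measurableT_comp measurable_T3 IH).
Qed.

Lemma measurable_iter_pre n A : measurable A -> measurable (iter n (@T3 R) @^-1` A).
Proof. by move=> mA; rewrite -[X in measurable X]setTI; exact: measurable_iter. Qed.

Lemma measurable_X : measurable X.
Proof.
rewrite (_ : X = \bigcap_n (iter n T3 @^-1` T3_dom)); last first.
  by apply/seteqP; split=> t tX n; [move=> _|]; apply: tX.
apply: bigcap_measurable => // n _.
by apply: measurable_iter_pre; exact: measurable_T3_dom.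
Qed.

(* The points at which T3^n is the last iterate that exists. *)
Fixpoint lost n : set (measurableTypeR R) :=
  if n is n'.+1 then T3_dom `&` T3 @^-1` lost n' else B `\` T3_dom.

(** [lost 0] is finite, hence null, and invariance of [mu_inv] keeps its successive preimages
    null. *)
Lemma lost_null n : [/\ measurable (lost n), lost n `<=` B & mu_inv (lost n) = 0%E].
Proof.
elim: n => [|n [mL LB L0]] /=.
  have mL : measurable (B `\` T3_dom).
    by apply: measurableD; [exact: measurable_itv|exact: measurable_T3_dom].
  have LB : B `\` T3_dom `<=` B by move=> t [].
  split=> //; apply/(mu_inv_eq0 _ mL LB).
  apply: countable_lebesgue_measure0; apply: finite_set_countable.
  exact: finite_T3_undefined.
split; [exact: measurable_preT|by move=> t [/T3_dom_itv]|].
by rewrite mu_inv_preT.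
Qed.

Lemma lost_cover : B `\` X `<=` \bigcup_n lost n.
Proof.
move=> t [tB /existsNP[n]]; elim: n t tB => [|n IH] t tB ntD.
  by exists 0.
have [tD|tD] := pselect (T3_dom t); last by exists 0.
have /T3_domE[i ti] := tD; have [Tt _] := branchK i t ti.
have [||m _ Lm] := IH (T3 t); first by rewrite /= in_itv.
  by rewrite -iterSr.
by exists m.+1.
Qed.

Lemma X_conull : leb (B `\` X) = 0%E.
Proof.
have mBX : measurable (B `\` X) by apply: measurableD; [exact: measurable_itv|exact: measurable_X].
apply/negligibleP => //; apply: negligibleS lost_cover _.
apply: negligible_bigcup => n; have [mL LB L0] := lost_null n.
by apply/negligibleP => //; apply/mu_inv_eq0.
Qed.

(** A point of [T3_dom] whose image has a full orbit has a full orbit itself. Invariance, proved for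
    preimages within [T3_dom], therefore transfers to [X]. *)
Lemma X_preT A : A `<=` X -> X `&` T3 @^-1` A = T3_dom `&` T3 @^-1` A.
Proof.
move=> AX; apply/seteqP; split=> t [tX tA]; split=> //; first exact: iterates_dom.
by apply: dom_iterates => //; exact: AX.
Qed.

Lemma mu_inv_X_preT A : measurable A -> A `<=` X ->
  mu_inv (X `&` T3 @^-1` A) = mu_inv A.
Proof.
move=> mA AX; rewrite X_preT// mu_inv_preT//.
exact: subset_trans AX iterates_itv.
Qed.

Lemma invariant_mu_inv : invariant_measure (@mu_inv R) X T3.
Proof.
split; first by apply: measurable_funTS; exact: measurable_T3.
exact: mu_inv_X_preT.
Qed.

Lemma mu_inv_X_iter A n : measurable A -> A `<=` X ->
  mu_inv (X `&` iter n T3 @^-1` A) = mu_inv A.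
Proof.
move=> mA AX; elim: n => [|n IH]; first by rewrite setIidr.
have mn : measurable (X `&` iter n T3 @^-1` A).
  by apply: measurableI; [exact: measurable_X|exact: measurable_iter_pre].
rewrite -[RHS]IH -[RHS]mu_inv_X_preT//; congr mu_inv.
apply/seteqP; split=> t; rewrite /= -/(iter n.+1 T3 t) ?iterSr => -[tX].
  by split=> //; split=> //; exact: iterates_T3.
by move=> [_ tA].
Qed.

Lemma sigma_finite_mu_inv : sigma_finite B (@mu_inv R).
Proof.
exists (fun n => `[n.+1%:R^-1, sqrt2[%classic).
  apply/seteqP; split=> [t|t [n _]]; rewrite /= !in_itv/= => /andP[t0 ts].
    have [n nt] := inv_succn_lt _ t0.
    by exists n => //=; rewrite in_itv/= ts ltW.
  by rewrite ts (lt_le_trans _ t0)//.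
move=> n; split; first exact: measurable_itv.
apply: le_lt_trans (ltry _); apply: (@mu_inv_le _ n.+1%:R^-1) => //.
by move=> t /=; rewrite !in_itv/= andbT => /andP[].
Qed.

End Iterates.

(** * Conservativity *)

Section Conservativity.
Context {R : realType}.
Local Notation B := (`]0, (sqrt2 : R)[%classic : set (measurableTypeR R)).
Local Notation X := (all_iterates_defined T3_dom (@T3 R) : set (measurableTypeR R)).
Implicit Types (t y : R) (A W : set (measurableTypeR R)).

(* The parabolic branch is the translation 1/t |-> 1/t - 1, so every orbit leaves it. *)
Lemma iter_T3_cut t : X t -> exists n, cut < iter n T3 t.
Proof.
move=> tX; apply: contrapT => /forallNP le_cut.
have /andP[s1 s2] := sqrt2_itv (R := R); have c := cutE (R := R).
have it n : 0 < iter n T3 t < cut.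
  have /T3_domP[] // := tX n => /andP[ic _]; exfalso; apply: (le_cut n) => //.
  by apply: lt_trans ic; rewrite c; lra.
have inv n : (iter n T3 t)^-1 = t^-1 - n%:R.
  elim: n => [|n IH]; first by rewrite subr0.
  rewrite /= -natr1 opprD addrA -IH {1}/T3 -/cut; have /andP[i0 ic] := it n.
  by rewrite ic invf_div; field; rewrite gt_eqF.
have /andP[t0 _] := it 0.
have /andP[n0 _] := it (Num.bound t^-1).
have := archi_boundP (ltW (_ : 0 < t^-1)); rewrite invr_gt0 t0 => /(_ isT) lt_bound.
by move: n0; rewrite -invr_gt0 inv subr_gt0 ltNge (ltW lt_bound).
Qed.

Lemma iter_T3_cut_often t n : X t -> exists2 m, (n <= m)%N & cut < iter m T3 t.
Proof.
move=> /(iterates_iter _ n)/iter_T3_cut[k ck]; exists (k + n)%N; first exact: leq_addl.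
by rewrite iterD.
Qed.

Let E : set (measurableTypeR R) := X `&` `]cut, +oo[.

Let mE : measurable E.
Proof. by apply: measurableI; [exact: measurable_X|exact: measurable_itv]. Qed.

(* For i <= n the sets T^-(n-i)(W /\ T^-i E) are disjoint subsets of T^-n E. *)
Lemma wandering_sum W n : measurable W -> W `<=` X ->
  trivIset setT (fun n => X `&` iter n T3 @^-1` W) ->
  (\sum_(0 <= i < n) mu_inv (W `&` iter i T3 @^-1` E) <= mu_inv E)%E.
Proof.
move=> mW WX tW.
pose S i := X `&` iter (n - i) T3 @^-1` (W `&` iter i T3 @^-1` E).
have mS i : measurable (S i).
  apply: measurableI; first exact: measurable_X.
  by apply: measurable_iter_pre; apply: measurableI => //; exact: measurable_iter_pre.
rewrite -(mu_inv_X_iter _ n mE); last by move=> t [].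
under eq_bigr => i _.
  rewrite -(mu_inv_X_iter _ (n - i)); last 2 first.
  - by apply: measurableI => //; exact: measurable_iter_pre.
  - by move=> t [/WX].
  over.
rewrite big_mkord -(@measure_semi_additive_ord _ _ _ (@mu_inv R) n (fun i => S i)) //.
- apply: le_measure; rewrite ?inE.
  + exact: bigsetU_measurable.
  + by apply: measurableI; [exact: measurable_X|exact: measurable_iter_pre].
  + rewrite -bigcup_mkord => t [i /= /ltnW ni [tX [_]]] /=.
    by rewrite -iterD subnKC.
(* Both indices are below [n], so the truncated subtractions [n - i] and [n - j] are genuine, and
   the wandering property makes them equal. *)
- move=> i j _ _ [t [[tX [tWi _]] [_ [tWj _]]]].
  apply: ord_inj; have : (n - i = n - j)%N.
    by apply: (tW (n - i)%N (n - j)%N) => //; exists t.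
  by move: (ltn_ord i) (ltn_ord j); lia.
- exact: bigsetU_measurable.
Qed.

Lemma conservative_mu_inv : conservative_measure (@mu_inv R) X T3.
Proof.
move=> [W [mW WX W0 tW]].
have c0 : 0 < cut :> R by have /andP[s1 s2] := sqrt2_itv (R := R); rewrite cutE; lra.
pose G n : set (measurableTypeR R) := W `&` iter n T3 @^-1` E.
have mG n : measurable (G n) by apply: measurableI => //; exact: measurable_iter_pre.
(* Visits to [E] recur beyond every [n], so [W] lies in the limit superior of the [G n], which
   Borel-Cantelli makes null. *)
have WG : W `<=` lim_sup_set G.
  move=> t tW' n _; have [m nm ct] := iter_T3_cut_often t n (WX t tW').
  exists m => //; split=> //; split; first exact/iterates_iter/WX.
  by rewrite /= in_itv/= andbT.
have Eoo : (mu_inv E < +oo)%E.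
  apply: le_lt_trans (ltry _); apply: (@mu_inv_le _ cut) => //.
  by move=> t [_]; rewrite /= !in_itv/= !andbT => /ltW.
have G0 : mu_inv (lim_sup_set G) = 0%E.
  apply: lim_sup_set_cvg0 => //; apply: le_lt_trans Eoo.
  by apply: lime_le; [exact: is_cvg_nneseries|apply: nearW => n; exact: wandering_sum].
have mlim : measurable (lim_sup_set G).
  by apply: bigcap_measurable => // n _; exact: bigcup_measurable.
have W0' : mu_inv W = 0%E by apply: subset_measure0 WG G0.
by have := W0; rewrite -[X in (_ < X)%E]/(mu_inv W) W0' ltxx.
Qed.

End Conservativity.

(** * Ergodicity *)

Section Expansion.
Context {R : realType}.
Local Notation leb := (@lebesgue_measure R).

(* The factor 2 is an artefact: the image of a set of diameter r is enclosed in a ball of radius L r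
   around one of its points. *)
Lemma lebesgue_measure_le_lipschitz (A E : set (measurableTypeR R)) (g : R -> R) (L : R) :
  0 < L -> measurable A -> (forall y, A y -> E (g y)) ->
  (forall y z, A y -> A z -> `|y - z| <= L * `|g y - g z|) ->
  (leb A <= (2 * L)%:E * leb E)%E.
Proof.
move=> L0 mA AE gL; have L20 : 0 < 2 * L by rewrite mulr_gt0.
(* [leb E] is an infimum over countable covers [F] of [E] by half-open intervals; each such cover is
   turned into a cover of [A]. *)
rewrite -lee_pdivrMl//; apply: le_ereal_inf_tmp => _ [F [mF EF] <-].
rewrite lee_pdivrMl//.
have w0 k : (0 <= wlength idfun (F k))%E by exact: wlength_ge0.
have /choice[K KP] (k : nat) : exists K : set (measurableTypeR R), [/\ measurable K,
    A `&` g @^-1` F k `<=` K & (leb K <= (2 * L)%:E * wlength idfun (F k))%E].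
  have /ocitvP[Fk|[[a b] /= ab Fk]] := mF k.
    exists set0; split=> //; first by rewrite Fk => t [].
    by rewrite measure0 mule_ge0// lee_fin ltW.
  have [[y0 [Ay0 gy0]]|] := pselect (A `&` g @^-1` F k !=set0); last first.
    move/set0P/negP/negPn/eqP => ->; exists set0; split=> //.
    by rewrite measure0 mule_ge0// lee_fin ltW.
  pose r := L * (b - a).
  have r0 : 0 < r by rewrite mulr_gt0// subr_gt0.
  exists `[y0 - r, y0 + r]%classic; split; first exact: measurable_itv.
    move=> y [Ay gy]; have : `|y - y0| <= r.
      apply: (le_trans (gL _ _ Ay Ay0)); rewrite ler_pM2l//.
      move: gy gy0; rewrite Fk /= !in_itv/= => /andP[? ?] /andP[? ?].
      by rewrite ler_norml; apply/andP; split; lra.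
    by rewrite ler_distl /= in_itv.
  rewrite lebesgue_measure_itv/= lte_fin Fk wlength_itv/= lte_fin ab.
  have -> : y0 - r < y0 + r by lra.
  by rewrite -!EFinB -EFinM lee_fin /r; lra.
have AK : A `<=` \bigcup_k K k.
  move=> y Ay; have [k _ Fk] := EF _ (AE y Ay).
  by exists k => //; have [_ + _] := KP k; apply.
apply: (@le_trans _ _ (leb (\bigcup_k K k))).
  apply: le_measure; rewrite ?inE//.
  by apply: bigcup_measurable => k _; have [] := KP k.
apply: (@le_trans _ _ (\sum_(k <oo) leb (K k))%E).
  apply: measure_sigma_subadditive => //; first by move=> k; have [] := KP k.
  by apply: bigcup_measurable => k _; have [] := KP k.
rewrite -nneseriesZl//; first by apply: lee_nneseries => // k _; have [] := KP k.
Qed.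

End Expansion.

(** * Cylinder maps and bounded distortion *)

Section Cylinders.
Context {R : realType}.
Local Notation leb := (@lebesgue_measure R).
Local Notation B := (`]0, (sqrt2 : R)[%classic : set (measurableTypeR R)).
Local Notation X := (all_iterates_defined T3_dom (@T3 R) : set (measurableTypeR R)).
Implicit Types (x y : R) (A : set (measurableTypeR R)).

Definition mob (a b c d y : R) : R := (a * y + b) / (c * y + d).

(* mob a b c d is a composition of n inverse branches mapping T3^n x to x. *)
Definition cylinder A x n (a b c d : R) : Prop :=
  [/\ 0 <= a, 0 <= b, 0 <= c & 0 < d] /\
  [/\ a * d - b * c != 0, mob a b c d (iter n T3 x) = x &
      forall y, A y -> A (mob a b c d y)].

(** Composition multiplies the coefficient matrix on the right by one of determinant 1, -2 or 2. The
    parabolic branch adds [d] to [c] and keeps [d]; each of the others at least doubles [d] and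
    gives [c' <= d']. *)
Lemma mob_branch (i : 'I_3) (a b c d : R) :
  [/\ 0 <= a, 0 <= b, 0 <= c & 0 < d] -> exists a' b' c' d',
  [/\ [/\ 0 <= a', 0 <= b', 0 <= c' & 0 < d'],
      forall y, 0 < y -> mob a b c d (branch i y) = mob a' b' c' d' y,
      `|a' * d' - b' * c'| = (if i == 0 then 1 else 2) * `|a * d - b * c|,
      (if i == 0 then d else 2 * d) <= d' & i != 0 -> c' <= d'].
Proof.
move=> [a0 b0 c0 d0]; have [-> | -> | ->] := ord3_cases i; rewrite /branch /mob /=.
- exists (a + b), b, (c + d), d; split=> //; first by split=> //; lra.
    by move=> y y0; field; rewrite !gt_eqF//; nra.
  by rewrite mul1r; congr `|_|; ring.
- exists b, (2 * a + 2 * b), d, (2 * c + 2 * d); split=> //; try lra.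
  + by split; lra.
  + by move=> y y0; field; rewrite !gt_eqF//; nra.
  + rewrite -[X in _ = X * _](@ger0_norm _ 2)// -normrM -normrN; congr `|_|; ring.
- exists (2 * a + b), (2 * a + 2 * b), (2 * c + d), (2 * c + 2 * d); split=> //; try lra.
  + by split; lra.
  + by move=> y y0; field; rewrite !gt_eqF//; nra.
  + rewrite -[X in _ = X * _](@ger0_norm _ 2)// -normrM; congr `|_|; ring.
Qed.

Definition branch_closed A := forall (i : 'I_3) y, A y -> A (branch i y).

(** [iter n T3 x] is the image of the next iterate under [branch i], so the new branch enters as the
    innermost factor. *)
Lemma cylinder_step A x n (a b c d : R) (i : 'I_3) :
  A `<=` B -> branch_closed A -> iter n T3 x \in branch_itv i ->
  cylinder A x n a b c d -> exists a' b' c' d',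
  [/\ cylinder A x n.+1 a' b' c' d',
      `|a' * d' - b' * c'| = (if i == 0 then 1 else 2) * `|a * d - b * c|,
      (if i == 0 then d else 2 * d) <= d' & i != 0 -> c' <= d'].
Proof.
move=> AB Ai xi [pos [det0 xE mobA]].
have [a' [b' [c' [d' [pos' mobE detE dd' cd']]]]] := mob_branch i _ _ _ _ pos.
have [/andP[y0 _] e] := branchK i _ xi.
exists a', b', c', d'; split=> //; split=> //; split.
- by rewrite -normr_gt0 detE mulr_gt0 ?normr_gt0//; case: ifP.
- by rewrite -mobE// e.
- move=> y Ay; rewrite -mobE; first exact/mobA/Ai.
  by have := AB y Ay; rewrite /= in_itv/= => /andP[].
Qed.

(* |det| / d^2 bounds the derivative of mob a b c d: it does not grow along the parabolic branch
   and is halved by the other two. *)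
Lemma cylinder_small A x (k : nat) : A `<=` B -> branch_closed A -> X x ->
  exists n a b c d, [/\ cylinder A x n a b c d, c <= d &
    `|a * d - b * c| * 2 ^+ k <= d ^+ 2].
Proof.
move=> AB Ai xX; elim: k => [|k [n [a [b [c [d [cyl _ small]]]]]]].
  exists 0%N, 1, 0, 0, 1; rewrite !mulr1 mulr0 subr0 normr1 expr1n; split=> //.
  split; first by split.
  by split=> [||y]; rewrite /mob ?mul1r ?mul0r ?subr0 ?oner_neq0 ?add0r ?addr0 ?divr1.
have [m ct] := iter_T3_cut _ (iterates_iter _ n xX).
(* Induction on the time [m] left until an iterate exceeds [cut]. Parabolic steps preserve the
   bound; the first other step, which occurs by then at the latest, doubles the determinant, at
   least quadruples [d ^+ 2], and so gains the factor 2. *)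
elim: m n a b c d ct cyl small => [|m IH] n a b c d ct cyl small;
  have /T3_domE[i xi] := xX n;
  have [a' [b' [c' [d' [cyl' detE dd' cd']]]]] := cylinder_step _ _ _ _ _ _ _ _ AB Ai xi cyl;
  have [[_ _ _ d0] _] := cyl; have [i0|i0] := eqVneq i 0.
- by move: xi; rewrite i0 /branch_itv/= in_itv/= => /andP[_ /lt_trans/(_ ct)]; rewrite ltxx.
- exists n.+1, a', b', c', d'; split=> //; first exact: cd'.
  rewrite detE (negbTE i0) exprS; rewrite (negbTE i0) in dd'.
  by have := normr_ge0 (a * d - b * c); nra.
- apply: (IH n.+1 a' b' c' d') => //; first by move: ct; rewrite iterSr.
  by rewrite detE i0 /= mul1r; rewrite i0 /= in dd'; nra.
- exists n.+1, a', b', c', d'; split=> //; first exact: cd'.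
  rewrite detE (negbTE i0) exprS; rewrite (negbTE i0) in dd'.
  by have := normr_ge0 (a * d - b * c); nra.
Qed.

Lemma mob_sub (a b c d y z : R) : 0 <= c -> 0 < d -> 0 < y -> 0 < z ->
  mob a b c d y - mob a b c d z =
  (a * d - b * c) * (y - z) / ((c * y + d) * (c * z + d)).
Proof. by move=> c0 d0 y0 z0; rewrite /mob; field; rewrite !gt_eqF//; nra. Qed.

(** Since [c <= d] and the points lie below 2, both denominators are between [d] and [3 * d]; their
    product gives the constant 9. *)
Lemma mob_dist (a b c d y z : R) : 0 <= c -> 0 < d -> c <= d ->
  0 < y < sqrt2 -> 0 < z < sqrt2 -> let D := `|a * d - b * c| in
  D * `|y - z| <= 9 * d ^+ 2 * `|mob a b c d y - mob a b c d z| /\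
  d ^+ 2 * `|mob a b c d y - mob a b c d z| <= D * `|y - z|.
Proof.
move=> c0 d0 cd /andP[y0 ys] /andP[z0 zs] D; have /andP[_ s2] := sqrt2_itv (R := R).
have yd : d <= c * y + d <= 3 * d by apply/andP; split; nra.
have zd : d <= c * z + d <= 3 * d by apply/andP; split; nra.
rewrite mob_sub// !normrM -/D normfV normrM.
rewrite (@ger0_norm _ (c * y + d)); last by nra.
rewrite (@ger0_norm _ (c * z + d)); last by nra.
have Dyz : 0 <= D * `|y - z| by rewrite /D mulr_ge0.
move: (D * _) (c * y + d) (c * z + d) Dyz yd zd => u p q u0 /andP[p1 p2] /andP[q1 q2].
have pq0 : 0 < p * q by rewrite mulr_gt0//; lra.
rewrite !mulrA ler_pdivlMr// ler_pdivrMr//; split; rewrite (mulrC _ u) ler_wpM2l//; nra.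
Qed.

(** A cylinder map carries all of [A] into [A] inside a small ball around [x], with bounded
    distortion. So [A] fills at least the proportion [leb A / 72] of that ball, a bound independent
    of [x] and [r]. *)
Lemma cylinder_scale A x (e : R) : measurable A -> A `<=` B -> branch_closed A -> X x ->
  0 < e -> exists2 r, 0 < r < e &
    (leb A <= (36 * r^-1)%:E * leb (A `&` ball x r))%E.
Proof.
move=> mA AB Ai xX e0.
have [k ke] : exists k, 2 / 2 ^+ k < e.
  exists (Num.bound (2 / e)); rewrite ltr_pdivrMr ?exprn_gt0// mulrC -ltr_pdivrMr//.
  exact: upper_nthrootP.
have [n [a [b [c [d [[[a0 b0 c0 d0] [det0 xE mobA]] cd small]]]]]] := cylinder_small _ _ k AB Ai xX.
have y0 : 0 < iter n T3 x < sqrt2.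
  by have := iterates_itv _ (iterates_iter _ n xX); rewrite /= in_itv.
have inB y : A y -> 0 < y < sqrt2 by move=> /AB; rewrite /= in_itv.
have D0 : 0 < `|a * d - b * c| by rewrite normr_gt0.
move: xE; move: (iter n T3 x) y0 => y0 y0B xE.
(* [|ad - bc| / d^2] is a Lipschitz constant of the cylinder map, and two points of []0, sqrt2[] are
   less than 2 apart. *)
pose r := 2 * `|a * d - b * c| / d ^+ 2.
have d20 : 0 < d ^+ 2 by rewrite exprn_gt0.
have r0 : 0 < r by rewrite divr_gt0// mulr_gt0.
exists r.
  rewrite r0 /=; apply: le_lt_trans ke; rewrite ler_pdivlMr ?exprn_gt0//.
  rewrite mulrAC ler_pdivrMr//; lra.
(* The inverse of the cylinder map has Lipschitz constant [9 d^2 / |ad - bc| = 18 / r]; the covering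
   estimate adds the factor 2. *)
have -> : 36 * r^-1 = 2 * (18 / r) by ring.
apply: (lebesgue_measure_le_lipschitz _ _ (mob a b c d)) => //.
- by rewrite divr_gt0.
- move=> y Ay; split; first exact: mobA.
  rewrite /ball/= -xE distrC.
  have [_ h] := mob_dist a b c d _ _ c0 d0 cd (inB _ Ay) y0B.
  rewrite /r ltr_pdivlMr// mulrC; apply: le_lt_trans h _; rewrite mulrC ltr_pM2r//.
  have /andP[_ s2] := sqrt2_itv (R := R).
  move: (inB _ Ay) y0B => /andP[? ?] /andP[? ?].
  by rewrite ltr_norml; apply/andP; split; lra.
- move=> y z Ay Az.
  have [h _] := mob_dist a b c d _ _ c0 d0 cd (inB _ Ay) (inB _ Az).
  rewrite -(ler_pM2l D0); apply: (le_trans h); rewrite [leRHS]mulrA ler_wpM2r//.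
  by rewrite /r le_eqVlt; apply/orP; left; apply/eqP; field; rewrite !gt_eqF.
Qed.

End Cylinders.

(** * Ergodicity by Lebesgue density *)

Section Ergodicity.
Context {R : realType}.
Local Notation leb := (@lebesgue_measure R).
Local Notation B := (`]0, (sqrt2 : R)[%classic : set (measurableTypeR R)).
Local Notation X := (all_iterates_defined T3_dom (@T3 R) : set (measurableTypeR R)).

Lemma invariant_branch_closed (A : set (measurableTypeR R)) :
  A `<=` X -> X `&` T3 @^-1` A = A -> branch_closed A.
Proof.
move=> AX AT i y Ay; have := iterates_itv _ (AX _ Ay); rewrite /= in_itv/= => yB.
have [bi e] := branch_mem i y yB.
rewrite -AT; split; last by rewrite /= e.
by apply: dom_iterates; [apply/T3_domE; exists i|rewrite e; exact: AX].
Qed.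

Lemma ergodic_mu_inv : ergodic_measure (@mu_inv R) X T3.
Proof.
move=> A mA AX AT; have AB : A `<=` B := subset_trans AX iterates_itv.
have XAB : X `\` A `<=` B by move=> t [/iterates_itv].
have mXA : measurable (X `\` A) by apply: measurableD => //; exact: measurable_X.
have [A0|A0] := eqVneq (mu_inv A) 0%E; [by left|right].
have lA0 : (0 < leb A)%E.
  rewrite lt0e measure_ge0 andbT; apply/eqP => /(mu_inv_eq0 _ mA AB) A0'.
  by rewrite A0' eqxx in A0.
apply/(mu_inv_eq0 _ mXA XAB)/negligibleP => //.
(* Every [x] in [X] outside [A] is exceptional for the density theorem: the density of [A] at [x]
   would have to be 0. *)
apply: negligibleS (lebesgue_density mA) => x [xX nxA] /=.
rewrite indicE memNset// => density0.
have lAfin : leb A = (fine (leb A))%:E.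
  by rewrite fineK// ge0_fin_numE// (le_lt_trans (leb_B_lty _ mA AB))// ltry.
have l0 : 0 < fine (leb A) by rewrite -lte_fin -lAfin.
(* 72 is 36 times the factor 2 in the length [2 r] of the ball. *)
have := open_ereal_lt' (_ : (0 < (fine (leb A) / 72)%:E)%E).
rewrite lte_fin divr_gt0// => /(_ isT)/density0[e /= e0 He].
have [r /andP[r0 re] scale] := cylinder_scale _ _ e mA AB (invariant_branch_closed _ AX AT) xX e0.
have : (leb (A `&` ball x r) * (leb (ball x r))^-1 < (fine (leb A) / 72)%:E)%E.
  by apply: He => //; rewrite /= sub0r normrN gtr0_norm.
rewrite lebesgue_measure_ball; last exact: ltW.
rewrite inver mulrn_eq0/= gt_eqF// => lt_ratio.
have : (leb A < leb A)%E.
  apply: le_lt_trans scale _.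
  have -> : (36 * r^-1)%:E = (72%:E * ((r *+ 2)^-1)%:E)%E.
    by rewrite -EFinM; congr EFin; field; rewrite gt_eqF.
  rewrite [ltRHS]lAfin (_ : fine _ = 72 * (fine (leb A) / 72)); last by field.
  by rewrite (EFinM 72) -muleA lte_pmul2l// muleC.
by rewrite ltxx.
Qed.

End Ergodicity.

Theorem theorem1p4 (R : realType) :
  [/\ matrix_generating_system N [:: vec3 1 7 5] F,
      is_system_under N (@conj_map R) `]0, sqrt2[ T3_dom T3 &
      let X : set R := all_iterates_defined T3_dom T3 in
      [/\ measurable X /\ lebesgue_measure (`]0, sqrt2[ `\` X) = 0%E,
          sigma_finite `]0, sqrt2[ (@mu_inv R),
          invariant_measure (@mu_inv R) X T3,
          ergodic_measure (@mu_inv R) X T3 &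
          conservative_measure (@mu_inv R) X T3]].
Proof.
split; [exact: matrix_generating_system_N|exact: is_system_under_T3|split].
- by split; [exact: measurable_X|exact: X_conull].
- exact: sigma_finite_mu_inv.
- exact: invariant_mu_inv.
- exact: ergodic_mu_inv.
- exact: conservative_mu_inv.
Qed.
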